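(* Let $\Bbbk$ be a field of characteristic $0$. For every integer $k\geq0$, the characteristic operation of the $k$-th Eulerian idempotent $\mathtt{E}_k$ on a connected bimonoid $\mathbf{h}$ in species over $\Bbbk$ is $$\Psi(\mathtt{E}_k)=\frac{1}{k!}(\log\mathrm{id})^{*k}.$$
   Context: Species and bimonoids. A species is a functor $\mathbf{p}$ from the category of finite sets and bijections to $\Bbbk$-vector spaces; morphisms are natural transformations. $I=S\sqcup T$ means that $(S,T)$ is an ordered pair of disjoint, possibly empty, subsets with union $I$. The Cauchy product is $(\mathbf{p}\cdot\mathbf{q})[I]=\bigoplus_{I=S\sqcup T}\mathbf{p}[S]\otimes\mathbf{q}[T]$; with the symmetry $x\otimes y\mapsto y\otimes x$ and unit the species that is $\Bbbk$ on $\emptyset$ and $0$ elsewhere, species form a symmetric monoidal category. Monoids, comonoids and bimonoids are taken in this category, with structure maps $\mu_{S,T},\iota_\emptyset$ (product $\mathbf{a}[S]\otimes\mathbf{a}[T]\to\mathbf{a}[I]$, unit) and $\Delta_{S,T},\epsilon_\emptyset$ (coproduct $\mathbf{c}[I]\to\mathbf{c}[S]\otimes\mathbf{c}[T]$, counit); in a bimonoid, product and unit are morphisms of comonoids. A bimonoid is connected if $\dim\mathbf{h}[\emptyset]=1$. Compositions. A composition $F=(I_1,\dots,I_k)\vDash I$ is a sequence of pairwise disjoint nonempty subsets (blocks) with union $I$; $\ell(F)=k$; $\mathrm{supp}\,F$ is the partition $\{I_1,\dots,I_k\}$. The unique composition of $\emptyset$ has no blocks and is denoted $\emptyset^0$.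 $\mu_F:\mathbf{h}[I_1]\otimes\cdots\otimes\mathbf{h}[I_k]\to\mathbf{h}[I]$ and $\Delta_F$ in the other direction are the iterated product and coproduct (identities for $k=1$; $\iota_\emptyset$, $\epsilon_\emptyset$ for $k=0$). Write $F\le G$ if each block of $F$ is a union of contiguous blocks of $G$; then $\ell(G/F)=\prod_i n_i$, where $n_i$ is the number of blocks of $G$ contained in the $i$-th block of $F$. $\mathbf{\Sigma}[I]$ is the vector space with basis $\mathtt{H}_F$, $F\vDash I$. Put $\mathtt{Q}_F=\sum_{G:\,F\le G}(-1)^{\ell(G)-\ell(F)}\frac{1}{\ell(G/F)}\mathtt{H}_G$. For a partition $X$ of a nonempty set $I$ with $\ell(X)$ blocks, $\mathtt{E}_X=\frac{1}{\ell(X)!}\sum_{F:\,\mathrm{supp}F=X}\mathtt{Q}_F$. For $k\ge1$, $\mathtt{E}_k$ is the series with components $\mathtt{E}_{k,\emptyset}=0$ and $\mathtt{E}_{k,I}=\sum_{X\vdash I,\ \ell(X)=k}\mathtt{E}_X$ for $I\ne\emptyset$; $\mathtt{E}_0$ is the series with $\mathtt{E}_{0,\emptyset}=\mathtt{H}_{\emptyset^0}$ and $\mathtt{E}_{0,I}=0$ for $I\ne\emptyset$. For $z=\sum_F a_F\mathtt{H}_F\in\mathbf{\Sigma}[I]$, $\Psi_I(z)=\sum_F a_F\,\mu_F\Delta_F\in\mathrm{End}_\Bbbk(\mathbf{h}[I])$; for a series $s=(s_I)$ of $\mathbf{\Sigma}$, $\Psi(s):\mathbf{h}\to\mathbf{h}$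 has components $\Psi_I(s_I)$. For species endomorphisms of $\mathbf{h}$, the convolution product is $(f*g)_I=\sum_{I=S\sqcup T}\mu_{S,T}(f_S\otimes g_T)\Delta_{S,T}$, with unit $u$ given by $u_\emptyset=\iota_\emptyset\epsilon_\emptyset$, $u_I=0$ for $I\neq\emptyset$; $f^{*k}$ is the $k$-th convolution power, $f^{*0}=u$. Finally $\log(\mathrm{id})=-\sum_{n\ge1}\frac1n(u-\mathrm{id})^{*n}$ (a finite sum on each component). *)

(* Defs.v *)
From HB Require Import structures.
From mathcomp Require Import boolp classical_sets functions cardinality fsbigop.
From mathcomp Require Import all_boot all_algebra.

Set Implicit Arguments.
Unset Strict Implicit.
Unset Printing Implicit Defensive.

Import GRing.Theory.
Local Open Scope ring_scope.

(** * The vector space of linear maps between two vector spaces *)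

Section LinearMaps.
Variables (K : fieldType) (U V : lmodType K).
Implicit Types f g h : {linear U -> V}.

Lemma linear_ext f g : f =1 g -> f = g.
Proof.
case: f g => [f [[mA] [mS]]] [g [[nA] [nS]]] /= /funext e.
case: _ / e nA nS => nA nS.
by rewrite (Prop_irrelevance mA nA) (Prop_irrelevance mS nS).
Qed.

Definition lin_of (f : U -> V) (H : linear f) : {linear U -> V} :=
  HB.pack_for {linear U -> V} f (GRing.isLinear.Build K U V *:%R f H).

Lemma lin0_subproof : linear (fun _ : U => 0 : V).
Proof. by move=> a x y; rewrite scaler0 addr0. Qed.
Lemma linN_subproof f : linear (fun x => - f x).
Proof. by move=> a x y; rewrite linearP opprD scalerN. Qed.
Lemma linD_subproof f g : linear (fun x => f x + g x).
Proof. by move=> a x y; rewrite !linearP scalerDr addrACA. Qed.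
Lemma linZ_subproof (c : K) f : linear (fun x => c *: f x).
Proof. by move=> a x y; rewrite linearP scalerDr !scalerA mulrC. Qed.

Definition lin0 := lin_of lin0_subproof.
Definition linN f := lin_of (linN_subproof f).
Definition linD f g := lin_of (linD_subproof f g).
Definition linZ c f := lin_of (linZ_subproof c f).

HB.instance Definition _ := gen_eqMixin {linear U -> V}.
HB.instance Definition _ := gen_choiceMixin {linear U -> V}.

Fact linDA : associative linD.
Proof. by move=> f g h; apply: linear_ext => x; exact: addrA. Qed.
Fact linDC : commutative linD.
Proof. by move=> f g; apply: linear_ext => x; exact: addrC. Qed.
Fact lin0D : left_id lin0 linD.
Proof. by move=> f; apply: linear_ext => x; exact: add0r. Qed.
Fact linND : left_inverse lin0 linN linD.
Proof. by move=> f; apply: linear_ext => x; exact: addNr. Qed.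
HB.instance Definition _ :=
  GRing.isZmodule.Build {linear U -> V} linDA linDC lin0D linND.

Fact linZA a b f : linZ a (linZ b f) = linZ (a * b) f.
Proof. by apply: linear_ext => x; exact: scalerA. Qed.
Fact lin1Z : left_id 1 linZ.
Proof. by move=> f; apply: linear_ext => x; exact: scale1r. Qed.
Fact linZDr : right_distributive linZ +%R.
Proof. by move=> a f g; apply: linear_ext => x; exact: scalerDr. Qed.
Fact linZDl f : {morph linZ^~ f : a b / a + b}.
Proof. by move=> a b; apply: linear_ext => x; exact: scalerDl. Qed.
HB.instance Definition _ :=
  GRing.Zmodule_isLmodule.Build K {linear U -> V} linZA lin1Z linZDr linZDl.

Lemma lin0E x : (0 : {linear U -> V}) x = 0. Proof. by []. Qed.
Lemma linNE f x : (- f : {linear U -> V}) x = - f x. Proof. by []. Qed.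
Lemma linDE f g x : (f + g : {linear U -> V}) x = f x + g x. Proof. by []. Qed.
Lemma linZE c f x : (c *: f : {linear U -> V}) x = c *: f x. Proof. by []. Qed.

Lemma lin_sumE (T : Type) (r : seq T) (P : pred T) (F : T -> {linear U -> V}) x :
  (\sum_(i <- r | P i) F i : {linear U -> V}) x = \sum_(i <- r | P i) F i x.
Proof. by elim/big_rec2: _ => // i y f _ <-. Qed.

End LinearMaps.

Section LinearComp.
Variables (K : fieldType) (U V W : lmodType K).

Lemma lin_id_subproof : linear (fun x : U => x).
Proof. by []. Qed.
Lemma lin_comp_subproof (g : {linear V -> W}) (f : {linear U -> V}) :
  linear (fun x => g (f x)).
Proof. by move=> a x y; rewrite !linearP. Qed.

Definition lin_id : {linear U -> U} := lin_of lin_id_subproof.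
Definition lin_comp (g : {linear V -> W}) (f : {linear U -> V}) : {linear U -> W} :=
  lin_of (lin_comp_subproof g f).

Lemma lin_idE x : lin_id x = x. Proof. by []. Qed.
Lemma lin_compE g f x : lin_comp g f x = g (f x). Proof. by []. Qed.

End LinearComp.

Arguments lin_id {K U}.

Notation "g '\lin_o' f" := (lin_comp g f)
  (at level 50, left associativity) : ring_scope.

(** * Tensor products of vector spaces *)

Section Tensor.
Variables (K : fieldType).

Definition bilin (U V W : lmodType K) (f : U -> V -> W) : Prop :=
  (forall u, linear (f u)) /\ (forall v, linear (f^~ v)).

Variables (U V : lmodType K).

(* The sequence [:: (u1, v1); ...; (un, vn)] stands for the formal sum of the
   ui (x) vi; tens_eval f is its value under a bilinear map f. *)
Definition tens_eval (W : lmodType K) (f : U -> V -> W) (s : seq (U * V)) : W :=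
  \sum_(p <- s) f p.1 p.2.

(* Formal sums are identified when no bilinear map separates them. *)
Definition tens_rel : rel (seq (U * V)) := fun s t =>
  `[< forall (W : lmodType K) (f : U -> V -> W), bilin f ->
        tens_eval f s = tens_eval f t >].

Fact tens_rel_refl : reflexive tens_rel.
Proof. by move=> s; apply/asboolP. Qed.
Fact tens_rel_sym : symmetric tens_rel.
Proof.
by move=> s t; apply/asboolP/asboolP => H W f Hf; rewrite H.
Qed.
Fact tens_rel_trans : transitive tens_rel.
Proof.
move=> t s r /asboolP H1 /asboolP H2; apply/asboolP => W f Hf.
by rewrite H1 // H2.
Qed.

Canonical tens_equiv :=
  EquivRel tens_rel tens_rel_refl tens_rel_sym tens_rel_trans.

Definition tensor : Type := {eq_quot tens_equiv}%qT.
HB.instance Definition _ := Choice.on tensor.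

Definition tens_class (s : seq (U * V)) : tensor :=
  (\pi_{eq_quot tens_equiv} s)%qT.
Definition tens_rep (t : tensor) : seq (U * V) := repr (t : {eq_quot tens_equiv}%qT).

Lemma tens_eval_class (W : lmodType K) (f : U -> V -> W) s : bilin f ->
  tens_eval f (tens_rep (tens_class s)) = tens_eval f s.
Proof.
move=> Hf; have : tens_rel (tens_rep (tens_class s)) s.
  by apply/(@eqquotP _ _ {eq_quot tens_equiv}%qT); rewrite reprK.
by move/asboolP; apply.
Qed.

Lemma tens_ext (x y : tensor) :
  (forall (W : lmodType K) (f : U -> V -> W), bilin f ->
     tens_eval f (tens_rep x) = tens_eval f (tens_rep y)) -> x = y.
Proof.
move=> H; rewrite -[x]reprK -[y]reprK.
by apply/(@eqquotP _ _ {eq_quot tens_equiv}%qT)/asboolP.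
Qed.

Definition tens0 : tensor := tens_class [::].
Definition tensD (x y : tensor) := tens_class (tens_rep x ++ tens_rep y).
Definition tensZ (c : K) (x : tensor) :=
  tens_class [seq (c *: p.1, p.2) | p <- tens_rep x].
Definition tensN (x : tensor) := tensZ (-1) x.

Section Eval.
Variables (W : lmodType K) (f : U -> V -> W) (Hf : bilin f).

Lemma tens_eval0 : tens_eval f (tens_rep tens0) = 0.
Proof. by rewrite tens_eval_class // /tens_eval big_nil. Qed.
Lemma tens_evalD x y : tens_eval f (tens_rep (tensD x y)) =
  tens_eval f (tens_rep x) + tens_eval f (tens_rep y).
Proof. by rewrite tens_eval_class // /tens_eval big_cat. Qed.
Lemma tens_evalZ c x :
  tens_eval f (tens_rep (tensZ c x)) = c *: tens_eval f (tens_rep x).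
Proof.
rewrite tens_eval_class // /tens_eval big_map scaler_sumr.
apply: eq_bigr => p _ /=.
exact: (linearZ_LR (lin_of (Hf.2 p.2))).
Qed.
Lemma tens_evalN x : tens_eval f (tens_rep (tensN x)) = - tens_eval f (tens_rep x).
Proof. by rewrite tens_evalZ scaleN1r. Qed.
End Eval.

Fact tensDA : associative tensD.
Proof. by move=> x y z; apply: tens_ext => W f Hf; rewrite !tens_evalD // addrA. Qed.
Fact tensDC : commutative tensD.
Proof. by move=> x y; apply: tens_ext => W f Hf; rewrite !tens_evalD // addrC. Qed.
Fact tens0D : left_id tens0 tensD.
Proof.
by move=> x; apply: tens_ext => W f Hf; rewrite tens_evalD // tens_eval0 // add0r.
Qed.
Fact tensND : left_inverse tens0 tensN tensD.
Proof.
move=> x; apply: tens_ext => W f Hf.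
by rewrite tens_evalD // tens_evalN // tens_eval0 // addNr.
Qed.
HB.instance Definition _ := GRing.isZmodule.Build tensor tensDA tensDC tens0D tensND.

Fact tensZA a b x : tensZ a (tensZ b x) = tensZ (a * b) x.
Proof. by apply: tens_ext => W f Hf; rewrite !tens_evalZ // scalerA. Qed.
Fact tens1Z : left_id 1 tensZ.
Proof. by move=> x; apply: tens_ext => W f Hf; rewrite tens_evalZ // scale1r. Qed.
Fact tensZDr : right_distributive tensZ +%R.
Proof.
move=> a x y; apply: tens_ext => W f Hf.
by rewrite !(tens_evalZ, tens_evalD) // scalerDr.
Qed.
Fact tensZDl x : {morph tensZ^~ x : a b / a + b}.
Proof.
move=> a b; apply: tens_ext => W f Hf.
by rewrite !(tens_evalZ, tens_evalD) // scalerDl.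
Qed.
HB.instance Definition _ :=
  GRing.Zmodule_isLmodule.Build K tensor tensZA tens1Z tensZDr tensZDl.

Definition tens (u : U) (v : V) : tensor := tens_class [:: (u, v)].

Lemma tens_eval_tens (W : lmodType K) (f : U -> V -> W) u v :
  bilin f -> tens_eval f (tens_rep (tens u v)) = f u v.
Proof. by move=> Hf; rewrite tens_eval_class // /tens_eval big_seq1. Qed.

Lemma tens_bilin : bilin tens.
Proof.
split=> [u a v v' | v a u u']; apply: tens_ext => W f Hf;
  rewrite tens_evalD // tens_evalZ // !tens_eval_tens //.
- exact: (Hf.1 u).
- exact: (Hf.2 v).
Qed.

Lemma tens_repE (x : tensor) : x = \sum_(p <- tens_rep x) tens p.1 p.2.
Proof.
apply: tens_ext => W f Hf; rewrite {1}/tens_eval.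
elim: (tens_rep x) => [|p s IHs].
  by rewrite !big_nil tens_eval0.
by rewrite !big_cons tens_evalD // tens_eval_tens // IHs.
Qed.

Section Lift.
Variables (W : lmodType K) (f : U -> V -> W) (Hf : bilin f).

Fact tens_lift_subproof : linear (fun x => tens_eval f (tens_rep x)).
Proof. by move=> a x y; rewrite tens_evalD // tens_evalZ. Qed.

Definition tens_lift : {linear tensor -> W} := lin_of tens_lift_subproof.

Lemma tens_liftE u v : tens_lift (tens u v) = f u v.
Proof. exact: tens_eval_tens. Qed.

End Lift.

Lemma tens_lin_ext (W : lmodType K) (f g : {linear tensor -> W}) :
  (forall u v, f (tens u v) = g (tens u v)) -> f = g.
Proof.
move=> H; apply: linear_ext => x; rewrite (tens_repE x) !linear_sum.
by apply: eq_bigr => p _; exact: H.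
Qed.

End Tensor.

Declare Scope tensor_scope.
Delimit Scope tensor_scope with T.
Local Open Scope tensor_scope.
Notation "U ⨂ V" := (tensor U V) (at level 40, left associativity) : tensor_scope.
Notation "u ⊗ v" := (tens u v) (at level 40, left associativity) : tensor_scope.

(* The one-dimensional space: K as a vector space over itself. *)
Notation base_space K := (GRing.GRing_regular__canonical__GRing_Lmodule K).

Section TensorMaps.
Variable (K : fieldType).

Fact tens_map_subproof (U U' V V' : lmodType K)
  (f : {linear U -> U'}) (g : {linear V -> V'}) : bilin (fun u v => f u ⊗ g v).
Proof.
split=> [u a v v' | v a u u']; rewrite linearP.
- exact: (tens_bilin _ _).1.
- exact: (tens_bilin _ _).2.
Qed.

Definition tens_map (U U' V V' : lmodType K)
  (f : {linear U -> U'}) (g : {linear V -> V'}) : {linear U ⨂ V -> U' ⨂ V'} :=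
  tens_lift (tens_map_subproof f g).

Fact tens_lunit_subproof (V : lmodType K) : bilin (fun (a : base_space K) (v : V) => a *: v).
Proof.
split=> [u | v] a x y /=; first by rewrite scalerDr !scalerA mulrC.
by rewrite scalerDl scalerA.
Qed.

Definition tens_lunit (V : lmodType K) : {linear base_space K ⨂ V -> V} :=
  tens_lift (tens_lunit_subproof V).

Fact tens_runit_subproof (V : lmodType K) : bilin (fun (v : V) (a : base_space K) => a *: v).
Proof. by case: (tens_lunit_subproof V). Qed.

Definition tens_runit (V : lmodType K) : {linear V ⨂ base_space K -> V} :=
  tens_lift (tens_runit_subproof V).

Lemma tens_lift_bilin (U V W X : lmodType K) (F : W -> U -> V -> X)
    (H : forall w, bilin (F w)) :
  (forall u v, linear (fun w => F w u v)) ->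
  bilin (fun (w : W) (t : U ⨂ V) => tens_lift (H w) t).
Proof.
move=> HW; split=> [w | t a w w']; first exact: linearP.
rewrite /tens_lift /= /tens_eval scaler_sumr -big_split /=.
by apply: eq_bigr => p _; exact: HW.
Qed.

Fact tens_assoc_subproof1 (U V W : lmodType K) (w : W) :
  bilin (fun (u : U) (v : V) => u ⊗ (v ⊗ w)).
Proof.
split=> [u a v v' | v a u u']; last exact: (tens_bilin _ _).2.
by rewrite (tens_bilin _ _).2 (tens_bilin _ _).1.
Qed.

Fact tens_assoc_subproof2 (U V W : lmodType K) :
  bilin (fun (t : U ⨂ V) (w : W) => tens_lift (tens_assoc_subproof1 U V w) t).
Proof.
have [H1 H2] := @tens_lift_bilin U V W _ _ (@tens_assoc_subproof1 U V W)
  (fun u v a w w' => ltac:(by rewrite /= !(tens_bilin _ _).1)).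
by split.
Qed.

Definition tens_assoc (U V W : lmodType K) :
    {linear (U ⨂ V) ⨂ W -> U ⨂ (V ⨂ W)} :=
  tens_lift (tens_assoc_subproof2 U V W).

Lemma tens_assocE (U V W : lmodType K) (u : U) (v : V) (w : W) :
  tens_assoc U V W ((u ⊗ v) ⊗ w) = u ⊗ (v ⊗ w).
Proof. by rewrite !tens_liftE. Qed.

Fact tens_swap_subproof1 (U V W X : lmodType K) (u : U) (v : V) :
  bilin (fun (w : W) (x : X) => (u ⊗ w) ⊗ (v ⊗ x)).
Proof.
split=> [w a x x' | x a w w'].
- by rewrite !(tens_bilin _ _).1.
- by rewrite (tens_bilin _ _).1 (tens_bilin _ _).2.
Qed.

Fact tens_swap_subproof2 (U V W X : lmodType K) (t : W ⨂ X) :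
  bilin (fun (u : U) (v : V) => tens_lift (tens_swap_subproof1 W X u v) t).
Proof.
split=> [u a v v' | v a u u'].
- have [_ H] := @tens_lift_bilin W X V _ _ (fun v => tens_swap_subproof1 W X u v)
    (fun w x b y z => ltac:(by rewrite /= (tens_bilin _ _).2 (tens_bilin _ _).1)).
  exact: H.
- have [_ H] := @tens_lift_bilin W X U _ _ (fun u => tens_swap_subproof1 W X u v)
    (fun w x b y z => ltac:(by rewrite /= !(tens_bilin _ _).2)).
  exact: H.
Qed.

Fact tens_swap_subproof3 (U V W X : lmodType K) :
  bilin (fun (s : U ⨂ V) (t : W ⨂ X) => tens_lift (tens_swap_subproof2 U V t) s).
Proof.
have [H1 H2] := @tens_lift_bilin U V (W ⨂ X) _ _ (@tens_swap_subproof2 U V W X)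
  (fun u v a w w' => ltac:(exact: linearP)).
by split.
Qed.

Definition tens_swap (U V W X : lmodType K) :
    {linear (U ⨂ V) ⨂ (W ⨂ X) -> (U ⨂ W) ⨂ (V ⨂ X)} :=
  tens_lift (tens_swap_subproof3 U V W X).

Lemma tens_swapE (U V W X : lmodType K) (u : U) (v : V) (w : W) (x : X) :
  tens_swap U V W X ((u ⊗ v) ⊗ (w ⊗ x)) = (u ⊗ w) ⊗ (v ⊗ x).
Proof. by rewrite !tens_liftE. Qed.

Lemma tens_mapE (U U' V V' : lmodType K)
    (f : {linear U -> U'}) (g : {linear V -> V'}) u v :
  tens_map f g (u ⊗ v) = f u ⊗ g v.
Proof. exact: tens_liftE. Qed.

Lemma tens_lunitE (V : lmodType K) a (v : V) : tens_lunit V (a ⊗ v) = a *: v.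
Proof. exact: tens_liftE. Qed.

Lemma tens_runitE (V : lmodType K) a (v : V) : tens_runit V (v ⊗ a) = a *: v.
Proof. exact: tens_liftE. Qed.

End TensorMaps.

(** * Species *)

(* A finite set is a finType, or a subset S : {set J} of a finType J, through
   the finType of its elements. *)
Definition elts (J : finType) (S : {set J}) : finType := {x : J | x \in S}.

Record species (K : fieldType) := Species {
  sp_obj :> finType -> lmodType K;
  sp_map : forall (I J : finType) (s : I -> J), bijective s ->
    {linear sp_obj I -> sp_obj J};
  sp_map_id : forall (I : finType) (bij_id : bijective (@id I)) x,
    sp_map bij_id x = x;
  sp_map_comp : forall (I J L : finType) (s : I -> J) (t : J -> L)
      (bij_s : bijective s) (bij_t : bijective t) (bij_ts : bijective (t \o s)) x,
    sp_map bij_ts x = sp_map bij_t (sp_map bij_s x)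
}.

Notation "p ⟦ S ⟧" := (sp_obj p (elts S))
  (at level 2, left associativity, format "p ⟦ S ⟧") : ring_scope.

Definition sp_cast (K : fieldType) (p : species K) (J : finType) (S T : {set J})
    (e : S = T) : {linear p⟦S⟧ -> p⟦T⟧} :=
  match e in _ = T0 return {linear p⟦S⟧ -> p⟦T0⟧} with
  | erefl => lin_id
  end.

(* I = S ⊔ T *)
Definition decomp (J : finType) (S T I : {set J}) : bool :=
  (S :|: T == I) && [disjoint S & T].

Definition restricts_to (J J' : finType) (I S : {set J}) (I' S' : {set J'})
    (s : elts I -> elts I') (r : elts S -> elts S') : Prop :=
  forall (x : elts I) (y : elts S), val x = val y -> val (s x) = val (r y).

(** * Monoids, comonoids, bimonoids *)

(* The components are indexed by the subsets S, T, I of an arbitrary ambient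
   finType J; naturality, which ranges over bijections between subsets of
   different ambient types, makes them independent of J. *)
Record monoid_on (K : fieldType) (p : species K) := MonoidOn {
  mu : forall (J : finType) (S T I : {set J}), decomp S T I ->
    {linear p⟦S⟧ ⨂ p⟦T⟧ -> p⟦I⟧};
  iota0 : forall J : finType, {linear base_space K -> p⟦set0 : {set J}⟧};
  mu_natural : forall (J J' : finType) (S T I : {set J}) (S' T' I' : {set J'})
      (d : decomp S T I) (d' : decomp S' T' I')
      (s : elts I -> elts I') (r : elts S -> elts S') (t : elts T -> elts T')
      (bs : bijective s) (br : bijective r) (bt : bijective t),
    restricts_to s r -> restricts_to s t ->
    forall x, sp_map p bs (mu d x) =
              mu d' (tens_map (sp_map p br) (sp_map p bt) x);
  iota0_natural : forall (J J' : finType)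
      (s : elts (set0 : {set J}) -> elts (set0 : {set J'})) (bs : bijective s) a,
    sp_map p bs (iota0 J a) = iota0 J' a;
  mu_assoc : forall (J : finType) (R S T RS ST I : {set J})
      (dRS : decomp R S RS) (dRS_T : decomp RS T I)
      (dST : decomp S T ST) (dR_ST : decomp R ST I) x,
    mu dRS_T (tens_map (mu dRS) lin_id x) =
    mu dR_ST (tens_map lin_id (mu dST) (tens_assoc _ _ _ x));
  mu_unitl : forall (J : finType) (I : {set J}) (d : decomp set0 I I) x,
    mu d (tens_map (iota0 J) lin_id x) = tens_lunit _ x;
  mu_unitr : forall (J : finType) (I : {set J}) (d : decomp I set0 I) x,
    mu d (tens_map lin_id (iota0 J) x) = tens_runit _ x
}.

Record comonoid_on (K : fieldType) (p : species K) := ComonoidOn {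
  Delta : forall (J : finType) (S T I : {set J}), decomp S T I ->
    {linear p⟦I⟧ -> p⟦S⟧ ⨂ p⟦T⟧};
  epsilon : forall J : finType, {linear p⟦set0 : {set J}⟧ -> base_space K};
  Delta_natural : forall (J J' : finType) (S T I : {set J}) (S' T' I' : {set J'})
      (d : decomp S T I) (d' : decomp S' T' I')
      (s : elts I -> elts I') (r : elts S -> elts S') (t : elts T -> elts T')
      (bs : bijective s) (br : bijective r) (bt : bijective t),
    restricts_to s r -> restricts_to s t ->
    forall x, Delta d' (sp_map p bs x) =
              tens_map (sp_map p br) (sp_map p bt) (Delta d x);
  epsilon_natural : forall (J J' : finType)
      (s : elts (set0 : {set J}) -> elts (set0 : {set J'})) (bs : bijective s) x,
    epsilon J' (sp_map p bs x) = epsilon J x;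
  Delta_coassoc : forall (J : finType) (R S T RS ST I : {set J})
      (dRS : decomp R S RS) (dRS_T : decomp RS T I)
      (dST : decomp S T ST) (dR_ST : decomp R ST I) x,
    tens_assoc _ _ _ (tens_map (Delta dRS) lin_id (Delta dRS_T x)) =
    tens_map lin_id (Delta dST) (Delta dR_ST x);
  Delta_counitl : forall (J : finType) (I : {set J}) (d : decomp set0 I I) x,
    tens_lunit _ (tens_map (epsilon J) lin_id (Delta d x)) = x;
  Delta_counitr : forall (J : finType) (I : {set J}) (d : decomp I set0 I) x,
    tens_runit _ (tens_map lin_id (epsilon J) (Delta d x)) = x
}.

Record bimonoid (K : fieldType) := Bimonoid {
  bim_sp :> species K;
  bim_mon :> monoid_on bim_sp;
  bim_comon :> comonoid_on bim_sp;
  (* The hypotheses say that A, B, C, D are the intersections of S, T with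
     S', T'. *)
  Delta_mu : forall (J : finType) (I S T S' T' A B C D : {set J})
      (d : decomp S T I) (d' : decomp S' T' I)
      (dS : decomp A B S) (dT : decomp C D T)
      (dS' : decomp A C S') (dT' : decomp B D T') x,
    Delta bim_comon d' (mu bim_mon d x) =
    tens_map (mu bim_mon dS') (mu bim_mon dT')
      (tens_swap _ _ _ _
        (tens_map (Delta bim_comon dS) (Delta bim_comon dT) x));
  epsilon_mu : forall (J : finType) (d : decomp set0 set0 (set0 : {set J})) x y,
    epsilon bim_comon J (mu bim_mon d (x ⊗ y)) =
    epsilon bim_comon J x * epsilon bim_comon J y;
  Delta_iota0 : forall (J : finType) (d : decomp set0 set0 (set0 : {set J})),
    Delta bim_comon d (iota0 bim_mon J 1) = iota0 bim_mon J 1 ⊗ iota0 bim_mon J 1;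
  epsilon_iota0 : forall J : finType, epsilon bim_comon J (iota0 bim_mon J 1) = 1
}.

(* dim h[∅] = 1 *)
Definition connected (K : fieldType) (h : bimonoid K) : Prop :=
  exists e : h void, forall x : h void, exists! a : K, x = a *: e.

(** * Set compositions *)

Definition is_comp (J : finType) (I : {set J}) (F : seq {set J}) : bool :=
  [&& set0 \notin F, pairwise (fun A B : {set J} => [disjoint A & B]) F
    & \bigcup_(B <- F) B == I].

Section Compositions.
Variable J : finType.
Implicit Types (A I : {set J}) (F G : seq {set J}).

Lemma is_comp_nil I : is_comp I [::] -> set0 = I.
Proof. by case/and3P => _ _ /eqP; rewrite big_nil. Qed.

Lemma is_comp_one A I : is_comp I [:: A] -> A = I.
Proof. by case/and3P => _ _ /eqP; rewrite big_seq1. Qed.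

Lemma is_comp_tail A F I : is_comp I (A :: F) -> is_comp (\bigcup_(B <- F) B) F.
Proof.
case/and3P; rewrite inE negb_or => /andP[_ F0] /= /andP[_ dF] _.
exact/and3P.
Qed.

Lemma is_comp_decomp A F I :
  is_comp I (A :: F) -> decomp A (\bigcup_(B <- F) B) I.
Proof.
case/and3P => _ /= /andP[dA _]; rewrite big_cons /decomp => -> /=.
elim: F dA => [|B F IH] /=; first by rewrite big_nil disjoints_subset setC0 subsetT.
by case/andP=> dB /IH; rewrite big_cons !disjoints_subset setCU subsetI
  -!disjoints_subset dB.
Qed.

Lemma size_is_comp I F : is_comp I F -> (size F <= #|J|)%N.
Proof.
move=> H; apply: (@leq_trans #|I|); last exact: max_card.
elim: F I H => [|A F IH] I H //=.
have /andP[/eqP <- dA] := is_comp_decomp H.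
have := IH _ (is_comp_tail H); rewrite -(leq_add2l #|A|) => le1.
rewrite cardsU (disjoint_setI0 dA) cards0 subn0; apply: leq_trans le1.
rewrite -add1n leq_add2r card_gt0.
by case/and3P: H; rewrite inE negb_or eq_sym => /andP[].
Qed.

Record composition I := Composition { blocks :> seq {set J}; blocksP : is_comp I blocks }.

HB.instance Definition _ I := [isSub for @blocks I].
HB.instance Definition _ I := [Choice of composition I by <:].

Section Finite.
Variable I : {set J}.

Definition comp_bseq (F : composition I) : #|J|.-bseq {set J} :=
  Bseq (size_is_comp (blocksP F)).
Definition bseq_comp (s : #|J|.-bseq {set J}) : option (composition I) :=
  insub (s : seq _).
Fact comp_bseqK : pcancel comp_bseq bseq_comp.
Proof. by move=> F; rewrite /bseq_comp /= (valK F). Qed.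
HB.instance Definition _ : Countable (composition I) :=
  Countable.copy (composition I) (pcan_type comp_bseqK).
HB.instance Definition _ : isFinite (composition I) :=
  PCanIsFinite comp_bseqK.
End Finite.

Lemma is_comp_set0 I : I == set0 -> is_comp I [::].
Proof. by move=> /eqP ->; rewrite /is_comp big_nil eqxx. Qed.

(* ∅^0, the composition of the empty set with no blocks *)
Definition comp0 I (I0 : I == set0) : composition I := Composition (is_comp_set0 I0).

Definition supp (F : seq {set J}) : {set {set J}} := [set B in F].

(* F <= G : the blocks of F are, in order, the unions of the runs into which
   G is cut. *)
Definition comp_le F G : bool :=
  `[< exists runs : seq (seq {set J}), flatten runs = G /\
        [seq \bigcup_(B <- r) B | r <- runs] = F >].

(* l(G/F) *)
Definition rel_length F G : nat :=
  (\prod_(A <- F) count (fun B : {set J} => B \subset A) G)%N.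

End Compositions.

(** * The species Σ and the Eulerian idempotents *)

Section Eulerian.
Variables (K : fieldType) (J : finType) (I : {set J}).

Definition Sigma : lmodType K := {ffun composition I -> K^o}.

Definition HH (F : composition I) : Sigma := [ffun G => (G == F)%:R].

Definition QQ (F : composition I) : Sigma :=
  \sum_(G : composition I | comp_le F G)
    ((-1) ^+ (size G - size F)%N * (rel_length F G)%:R^-1) *: HH G.

Definition EE (X : {set {set J}}) : Sigma :=
  (#|X| `!)%:R^-1 *: \sum_(F : composition I | supp F == X) QQ F.

Definition Euler (k : nat) : Sigma :=
  match k, @idP (I == set0) with
  | 0, ReflectT I0 => HH (comp0 I0)
  | 0, ReflectF _ => 0
  | _.+1, ReflectT _ => 0
  | _.+1, ReflectF _ =>
      \sum_(X : {set {set J}} | partition X I && (#|X| == k)) EE X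
  end.

End Eulerian.

(** * Characteristic operations *)

Section CharacteristicOperation.
Variables (K : fieldType) (h : bimonoid K).

(* h[I_1] ⨂ (h[I_2] ⨂ ( ... ⨂ h[I_k])), and K for k = 0 *)
Fixpoint tens_blocks (J : finType) (F : seq {set J}) : lmodType K :=
  match F with
  | [::] => base_space K
  | A :: F' => match F' with
               | [::] => h⟦A⟧
               | _ :: _ => h⟦A⟧ ⨂ tens_blocks F'
               end
  end.

Fixpoint mu_comp (J : finType) (F : seq {set J}) :
    forall I, is_comp I F -> {linear tens_blocks F -> h⟦I⟧} :=
  match F return forall I, is_comp I F -> {linear tens_blocks F -> h⟦I⟧} with
  | [::] => fun I c => sp_cast h (is_comp_nil c) \lin_o iota0 h J
  | A :: F' =>
    match F' return
        (forall I, is_comp I F' -> {linear tens_blocks F' -> h⟦I⟧}) ->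
        forall I, is_comp I (A :: F') -> {linear tens_blocks (A :: F') -> h⟦I⟧}
    with
    | [::] => fun _ I c => sp_cast h (is_comp_one c)
    | _ :: _ => fun mu_F' I c =>
        mu h (is_comp_decomp c) \lin_o tens_map lin_id (mu_F' _ (is_comp_tail c))
    end (@mu_comp J F')
  end.

Fixpoint Delta_comp (J : finType) (F : seq {set J}) :
    forall I, is_comp I F -> {linear h⟦I⟧ -> tens_blocks F} :=
  match F return forall I, is_comp I F -> {linear h⟦I⟧ -> tens_blocks F} with
  | [::] => fun I c => epsilon h J \lin_o sp_cast h (esym (is_comp_nil c))
  | A :: F' =>
    match F' return
        (forall I, is_comp I F' -> {linear h⟦I⟧ -> tens_blocks F'}) ->
        forall I, is_comp I (A :: F') -> {linear h⟦I⟧ -> tens_blocks (A :: F')}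
    with
    | [::] => fun _ I c => sp_cast h (esym (is_comp_one c))
    | _ :: _ => fun Delta_F' I c =>
        tens_map lin_id (Delta_F' _ (is_comp_tail c)) \lin_o Delta h (is_comp_decomp c)
    end (@Delta_comp J F')
  end.

(* Families of endomorphisms of the spaces h[I] *)
Definition endo := forall (J : finType) (I : {set J}), {linear h⟦I⟧ -> h⟦I⟧}.

Definition Psi (s : forall (J : finType) (I : {set J}), Sigma K I) : endo :=
  fun J I => \sum_(F : composition I)
    s J I F *: (mu_comp (blocksP F) \lin_o Delta_comp (blocksP F)).

Definition conv (f g : endo) : endo := fun J I =>
  \sum_(d : {d : {set J} * {set J} | decomp d.1 d.2 I})
    (mu h (valP d) \lin_o tens_map (f J (val d).1) (g J (val d).2)
       \lin_o Delta h (valP d)).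

Definition conv_unit : endo := fun J I =>
  match set0 =P I with
  | ReflectT e => sp_cast h e \lin_o (iota0 h J \lin_o epsilon h J)
                    \lin_o sp_cast h (esym e)
  | ReflectF _ => 0
  end.

Definition conv_pow (f : endo) (n : nat) : endo := iter n (conv f) conv_unit.

(* The sum is that of a finitely supported family, separately for each I. *)
Definition log_id : endo := fun J I =>
  - \sum_(n \in [set n | (0 < n)%N]%classic)
      n%:R^-1 *: conv_pow (fun J I => conv_unit I - lin_id) n I.

End CharacteristicOperation.

(* Main.v *)
(** For a polynomial p, let [ev p] be the operator sum_F p_(l(F)) mu_F Delta_F.
    Associativity of convolution makes [ev] turn products of polynomials into
    convolutions, and [ev 'X] is the projection id - u when h is connected.
    Hence log id is, on subsets of a fixed finite set, [ev] of a truncation of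
    log(1 + X), and (log id)^{*k} is [ev] of its k-th power. On the other side,
    the coefficient of H_G in k! E_k is the sum, over all ways of cutting G
    into k nonempty runs of lengths n_i, of the product of the
    (-1)^(n_i - 1) / n_i, which is the coefficient of X^(l(G)) in log(1 + X)^k. *)

From mathcomp Require Import boolp classical_sets fsbigop.
Require Import Defs.
From mathcomp Require Import all_boot all_algebra.

Set Implicit Arguments.
Unset Strict Implicit.
Unset Printing Implicit Defensive.

Import GRing.Theory.
Local Open Scope ring_scope.
Local Open Scope tensor_scope.

(** * Tensor products of maps *)

Section TensorMapTheory.
Variable K : fieldType.

Lemma tens_map_bilin (U U' V V' : lmodType K) :
  bilin (@tens_map K U U' V V').
Proof.
split=> [f a g g'|g a f f']; apply: tens_lin_ext => u v.
- by rewrite linDE linZE !tens_mapE linDE linZE (tens_bilin _ _).1.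
- by rewrite linDE linZE !tens_mapE linDE linZE (tens_bilin _ _).2.
Qed.

Lemma tens_map_comp (U U' U'' V V' V'' : lmodType K)
    (f' : {linear U' -> U''}) (f : {linear U -> U'})
    (g' : {linear V' -> V''}) (g : {linear V -> V'}) x :
  tens_map (f' \lin_o f) (g' \lin_o g) x = tens_map f' g' (tens_map f g x).
Proof.
rewrite -(lin_compE (tens_map f' g')); congr ((_ : {linear _ -> _}) x).
by apply: tens_lin_ext => u v; rewrite lin_compE !tens_mapE.
Qed.

Lemma lin_comp1l (U V : lmodType K) (f : {linear U -> V}) : lin_id \lin_o f = f.
Proof. exact: linear_ext. Qed.

Lemma lin_comp1r (U V : lmodType K) (f : {linear U -> V}) : f \lin_o lin_id = f.
Proof. exact: linear_ext. Qed.

Lemma tens_suml (U V : lmodType K) (X : Type) (s : seq X) (F : X -> U) (v : V) :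
  (\sum_(i <- s) F i) ⊗ v = \sum_(i <- s) F i ⊗ v.
Proof. exact: (linear_sum (lin_of ((tens_bilin U V).2 v))). Qed.

Lemma tens_assoc_nat (U U' V V' W W' : lmodType K) (f : {linear U -> U'})
    (g : {linear V -> V'}) (k : {linear W -> W'}) x :
  tens_assoc _ _ _ (tens_map (tens_map f g) k x) =
  tens_map f (tens_map g k) (tens_assoc _ _ _ x).
Proof.
rewrite (tens_repE x) !linear_sum; apply: eq_bigr => -[t w] _.
rewrite [(_, w).1](tens_repE t) tens_suml !linear_sum; apply: eq_bigr => -[u v] _.
by rewrite !(tens_assocE, tens_mapE).
Qed.

Lemma tens_lunit_nat (V V' : lmodType K) (g : {linear V -> V'}) x :
  tens_lunit _ (tens_map lin_id g x) = g (tens_lunit _ x).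
Proof.
rewrite -[LHS]lin_compE -[RHS](lin_compE g); congr ((_ : {linear _ -> _}) x).
by apply: tens_lin_ext => a v; rewrite !lin_compE tens_mapE !tens_lunitE linearZ.
Qed.

Lemma tens_runit_nat (V V' : lmodType K) (g : {linear V -> V'}) x :
  tens_runit _ (tens_map g lin_id x) = g (tens_runit _ x).
Proof.
rewrite -[LHS]lin_compE -[RHS](lin_compE g); congr ((_ : {linear _ -> _}) x).
by apply: tens_lin_ext => a v; rewrite !lin_compE tens_mapE !tens_runitE linearZ.
Qed.

End TensorMapTheory.

(** * Convolution *)

Section Convolution.
Variables (K : fieldType) (h : bimonoid K) (J : finType).
Implicit Types R S T I : {set J}.

(** Made total, with value 0 off decompositions, so that sums can range over subsets without
    index-dependent proofs. *)
Definition conv_part S T I (f : {linear h⟦S⟧ -> h⟦S⟧})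
    (g : {linear h⟦T⟧ -> h⟦T⟧}) : {linear h⟦I⟧ -> h⟦I⟧} :=
  match @idP (decomp S T I) with
  | ReflectT d => mu h d \lin_o tens_map f g \lin_o Delta h d
  | ReflectF _ => 0
  end.
Arguments conv_part : clear implicits.

Lemma conv_partE S T I (d : decomp S T I) f g :
  conv_part S T I f g = mu h d \lin_o tens_map f g \lin_o Delta h d.
Proof.
by rewrite /conv_part; case: {-}_ / idP => // d'; rewrite (bool_irrelevance d' d).
Qed.

Lemma conv_part_bilin S T I : bilin (conv_part S T I).
Proof.
have [d|d] := boolP (decomp S T I); last first.
  have z f g : conv_part S T I f g = 0.
    by rewrite /conv_part; case: {-}_ / idP => // d'; rewrite d' in d.
  by split=> [f a g g'|g a f f']; rewrite !z scaler0 addr0.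
split=> [f a g g'|g a f f']; apply: linear_ext => x;
  rewrite linDE linZE !(conv_partE d) !lin_compE.
- by rewrite (tens_map_bilin _ _ _ _).1 linDE linZE linearP.
- by rewrite (tens_map_bilin _ _ _ _).2 linDE linZE linearP.
Qed.

Lemma conv_part_sumr S T I (X : finType) (P : pred X) f G :
  conv_part S T I f (\sum_(i | P i) G i) = \sum_(i | P i) conv_part S T I f (G i).
Proof. exact: (linear_sum (lin_of ((conv_part_bilin S T I).1 f))). Qed.

Lemma conv_part_suml S T I (X : finType) (P : pred X) G g :
  conv_part S T I (\sum_(i | P i) G i) g = \sum_(i | P i) conv_part S T I (G i) g.
Proof. exact: (linear_sum (lin_of ((conv_part_bilin S T I).2 g))). Qed.

Lemma conv_partZr S T I a f g :
  conv_part S T I f (a *: g) = a *: conv_part S T I f g.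
Proof. exact: (linearZ_LR (lin_of ((conv_part_bilin S T I).1 f))). Qed.

Lemma conv_partPl S T I a f f' g :
  conv_part S T I (a *: f + f') g = a *: conv_part S T I f g + conv_part S T I f' g.
Proof. exact: (conv_part_bilin S T I).2. Qed.

Lemma conv_part0l S T I g : conv_part S T I 0 g = 0.
Proof. exact: (linear0 (lin_of ((conv_part_bilin S T I).2 g))). Qed.

Lemma conv_part0r S T I f : conv_part S T I f 0 = 0.
Proof. exact: (linear0 (lin_of ((conv_part_bilin S T I).1 f))). Qed.

Lemma decompE S T I : decomp S T I = (S \subset I) && (T == I :\: S).
Proof.
rewrite /decomp; apply/andP/andP=> -[].
  move=> /eqP <- dST; split; first exact: subsetUl.
  rewrite setDUl setDv set0U eq_sym; apply/eqP/setDidPl.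
  by rewrite disjoint_sym.
move=> sSI /eqP ->; split; first by rewrite -{1}(setIidPr sSI) setID.
by rewrite disjoints_subset setCD subsetUr.
Qed.

(** A decomposition of [I] is determined by its first part, the second being the complement. *)
Lemma convE (f g : endo h) I :
  conv f g I = \sum_(S : {set J} | S \subset I)
    conv_part S (I :\: S) I (f J S) (g J (I :\: S)).
Proof.
rewrite /conv; under eq_bigr => d _ do rewrite -conv_partE.
rewrite -(big_sub [pred d : {set J} * {set J} | decomp d.1 d.2 I]
  (fun d => conv_part d.1 d.2 I (f J d.1) (g J d.2))).
rewrite (reindex_onto (fun S => (S, I :\: S)) fst) => [|[S T]]; last first.
  by rewrite inE /= decompE => /andP[_ /eqP ->].
by apply: eq_bigl => S; rewrite inE /= decompE !eqxx !andbT.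
Qed.

(** Functoriality of the tensor product splits both sides into coproducts, then maps, then products;
    coassociativity, naturality of the associator and associativity match these layers. *)
Lemma conv_part_assoc R S T RS ST I f g k :
  decomp R S RS -> decomp RS T I -> decomp S T ST -> decomp R ST I ->
  conv_part RS T I (conv_part R S RS f g) k =
  conv_part R ST I f (conv_part S T ST g k).
Proof.
move=> dRS dRS_T dST dR_ST; apply: linear_ext => x.
rewrite (conv_partE dRS) (conv_partE dRS_T) (conv_partE dST) (conv_partE dR_ST).
rewrite !lin_compE.
have -> (X Y : lmodType K) (m : {linear Y -> h⟦RS⟧}) (t : {linear X -> Y})
    (D : {linear h⟦RS⟧ -> X}) y :
    tens_map (m \lin_o t \lin_o D) k y =
    tens_map m lin_id (tens_map t k (tens_map D lin_id y)).
  by rewrite -!tens_map_comp lin_comp1l lin_comp1r.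
have -> (X Y : lmodType K) (m : {linear Y -> h⟦ST⟧}) (t : {linear X -> Y})
    (D : {linear h⟦ST⟧ -> X}) y :
    tens_map f (m \lin_o t \lin_o D) y =
    tens_map lin_id m (tens_map f t (tens_map lin_id D y)).
  by rewrite -!tens_map_comp lin_comp1l lin_comp1r.
rewrite (mu_assoc h dRS dRS_T dST dR_ST) tens_assoc_nat.
by rewrite (Delta_coassoc h dRS dRS_T dST dR_ST).
Qed.

(** Both sides sum over ordered splittings of [I] into three parts; the left side first chooses the
    union [U] of the first two parts, the right side first chooses [R]. *)
Lemma convA (f g k : endo h) I : conv (conv f g) k I = conv f (conv g k) I.
Proof.
rewrite !convE.
under eq_bigr => U _ do rewrite convE conv_part_suml.
under [RHS]eq_bigr => S _ do rewrite convE conv_part_sumr.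
rewrite (exchange_big_dep (fun R : {set J} => R \subset I)) /=; last first.
  by move=> U R UI RU; exact: subset_trans RU UI.
apply: eq_bigr => R RI.
(* With [R] fixed, writing [U = R :|: S] makes the second part [S] the summation variable. *)
rewrite (reindex_onto (fun S => R :|: S) (fun U => U :\: R)) /=; last first.
  by move=> U /andP[_ RU]; rewrite -{1}(setIidPr RU) setID.
apply: eq_big => [S|S].
  rewrite subUset RI subsetUl andbT /= setDUl setDv set0U subsetD.
  by congr (_ && _); apply/eqP/setDidPl.
rewrite subUset subsetUl andbT => /andP[/andP[_ SI] /eqP e].
rewrite e -setDDl.
have sSR : S \subset I :\: R by rewrite -e setDUl setDv set0U setSD.
apply: conv_part_assoc; rewrite decompE ?subsetUl ?e ?sSR ?RI ?eqxx //.
by rewrite subUset RI SI setDDl eqxx.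
Qed.

(** Agreement over the single ambient set [J] suffices; this matters because the truncation of the
    logarithm depends on [J]. *)
Lemma eq_conv (f f' g g' : endo h) I :
  (forall S, f J S = f' J S) -> (forall S, g J S = g' J S) ->
  conv f g I = conv f' g' I.
Proof. by move=> ef eg; rewrite !convE; apply: eq_bigr => S _; rewrite ef eg. Qed.

Lemma conv_unit0 : conv_unit h (set0 : {set J}) = iota0 h J \lin_o epsilon h J.
Proof.
rewrite /conv_unit; case: eqP => // e.
by rewrite (Prop_irrelevance e erefl); exact: linear_ext.
Qed.

Lemma conv_unitN0 I : I != set0 -> conv_unit h I = 0.
Proof. by rewrite /conv_unit eq_sym; case: eqP. Qed.

(** The middle map factors as counit, then [g], then unit, so the unit and counit axioms cancel
    around [g]. *)
Lemma conv_part_unitl I g :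
  conv_part set0 I I (iota0 h J \lin_o epsilon h J) g = g.
Proof.
have d : decomp set0 I I by rewrite decompE sub0set setD0 eqxx.
rewrite (conv_partE d); apply: linear_ext => x; rewrite !lin_compE.
have -> y : tens_map (iota0 h J \lin_o epsilon h J) g y =
    tens_map (iota0 h J) lin_id (tens_map lin_id g (tens_map (epsilon h J) lin_id y)).
  by rewrite -!tens_map_comp !lin_comp1l !lin_comp1r.
by rewrite mu_unitl tens_lunit_nat Delta_counitl.
Qed.

Lemma conv_part_unitr I g :
  conv_part I set0 I g (iota0 h J \lin_o epsilon h J) = g.
Proof.
have d : decomp I set0 I by rewrite decompE subxx setDv eqxx.
rewrite (conv_partE d); apply: linear_ext => x; rewrite !lin_compE.
have -> y : tens_map g (iota0 h J \lin_o epsilon h J) y =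
    tens_map lin_id (iota0 h J) (tens_map g lin_id (tens_map lin_id (epsilon h J) y)).
  by rewrite -!tens_map_comp !lin_comp1l !lin_comp1r.
by rewrite mu_unitr tens_runit_nat Delta_counitr.
Qed.

Lemma conv_unitl (g : endo h) I : conv (conv_unit h) g I = g J I.
Proof.
rewrite convE (bigD1 set0) ?sub0set //= big1 => [|S /andP[_ S0]].
  by rewrite addr0 setD0 conv_unit0 conv_part_unitl.
by rewrite conv_unitN0 // conv_part0l.
Qed.

End Convolution.

Arguments conv_part {K h J} S T I f g.

(** * Operators attached to compositions *)

Section IsComp.
Variable J : finType.
Implicit Types (A I : {set J}) (F G : seq {set J}).

Lemma is_comp_cons A F I :
  is_comp I (A :: F) = [&& A != set0, A \subset I & is_comp (I :\: A) F].
Proof.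
apply/idP/and3P=> [c|[A0 AI /and3P[F0 pF /eqP eF]]].
  have := is_comp_decomp c; rewrite decompE => /andP[AI /eqP <-].
  split=> //; last exact: is_comp_tail c.
  by case/and3P: c; rewrite inE negb_or eq_sym => /andP[].
rewrite /is_comp inE negb_or eq_sym A0 F0 /= pF andbT big_cons eF.
rewrite -{2}(setIidPr AI) setID eqxx andbT.
apply/allP => B BF; have: B \subset I :\: A by rewrite -eF (big_rem B BF) /= subsetUl.
by rewrite subsetD disjoint_sym => /andP[].
Qed.

Lemma is_comp_nilE I : is_comp I [::] = (I == set0).
Proof. by rewrite /is_comp big_nil eq_sym. Qed.

(** Recursion on the first block. Taking [g] on bare lists avoids comparing the types
    [composition (I :\: A)] for varying [A]. *)
Lemma sum_comp (V : nmodType) I (g : seq {set J} -> V) :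
  \sum_(F : composition I) g F =
  (if I == set0 then g [::] else 0) +
  \sum_(A : {set J} | (A \subset I) && (A != set0))
    \sum_(F : composition (I :\: A)) g (A :: F).
Proof.
pose rA := [seq A : {set J} <- index_enum {set J} | (A \subset I) && (A != set0)].
pose r (A : {set J}) := [seq blocks c | c <- index_enum (composition (I :\: A))].
pose r0 := if I == set0 then [:: [::]] else [::] : seq (seq {set J}).
pose r1 := [seq A :: F | A <- rA, F <- r A].
(* Both lists are duplicate-free and have the same members, namely the compositions of [I]. *)
have pr : perm_eq [seq blocks c | c <- index_enum (composition I)] (r0 ++ r1).
  have inr K F : (F \in [seq blocks c | c <- index_enum (composition K)]) = is_comp K F.
    apply/mapP/idP => [[{}F _ ->]|c]; first exact: blocksP.
    by exists (Composition c) => //; rewrite mem_index_enum.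
  have unr K : uniq [seq blocks c | c <- index_enum (composition K)].
    by rewrite map_inj_uniq ?index_enum_uniq //; exact: val_inj.
  have r1P F : reflect (exists A F', F = A :: F' /\ is_comp I F) (F \in r1).
    apply: (iffP allpairsPdep) => [[A [F' []]]|[A [F' [-> c]]]].
      rewrite mem_filter mem_index_enum andbT inr => /andP[AI A0] c ->.
      by exists A, F'; rewrite is_comp_cons A0 AI c.
    exists A, F'; move: c; rewrite is_comp_cons => /and3P[A0 AI c].
    by rewrite mem_filter mem_index_enum andbT inr A0 AI c.
  apply: uniq_perm => //.
    rewrite cat_uniq; apply/and3P; split.
    - by rewrite /r0; case: ifP.
    - apply/hasPn => F /r1P[A [F' [-> _]]]; by rewrite /r0; case: ifP; rewrite ?inE.
    - apply: allpairs_uniq_dep => [|A _|]; first by rewrite filter_uniq ?index_enum_uniq.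
        exact: unr.
      by move=> [A F] [A' F'] _ _ /= [-> ->].
  move=> F; rewrite inr mem_cat; case: F => [|A F].
    rewrite is_comp_nilE /r0; case: ifP => _; rewrite ?inE //=.
    by apply/esym/negbTE/r1P => -[A [F' []]].
  have -> : (A :: F \in r0) = false by rewrite /r0; case: ifP; rewrite ?inE.
  by apply/idP/r1P => [c|[A' [F' [_ //]]]]; exists A, F.
rewrite -(big_map (@blocks J I) xpredT g) (perm_big _ pr) big_cat; congr (_ + _).
  by rewrite /r0; case: ifP => _; rewrite ?big_seq1 ?big_nil.
rewrite big_allpairs_dep big_filter; apply: eq_bigr => A _.
by rewrite big_map.
Qed.

End IsComp.

(** * The operators mu_F Delta_F and their recursion *)

Section CompOp.
Variables (K : fieldType) (h : bimonoid K) (J : finType).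
Implicit Types (A I : {set J}) (F G : seq {set J}).

(** Extended by 0 to all lists, so that it can be summed with [sum_comp]. *)
Definition comp_op I F : {linear h⟦I⟧ -> h⟦I⟧} :=
  if insub F is Some c
  then mu_comp h (blocksP (c : composition I)) \lin_o Delta_comp h (blocksP c) else 0.

Lemma comp_opE I F (c : is_comp I F) :
  comp_op I F = @mu_comp K h J F I c \lin_o @Delta_comp K h J F I c.
Proof. by rewrite /comp_op (insubT (is_comp I) c). Qed.

Lemma comp_op_nil : comp_op set0 [::] = iota0 h J \lin_o epsilon h J.
Proof.
have c : is_comp (set0 : {set J}) [::] by rewrite is_comp_nilE.
rewrite (comp_opE c) /=; move: (is_comp_nil c) => e.
by rewrite (Prop_irrelevance e erefl); exact: linear_ext.
Qed.

Lemma comp_op_cons A F I : A != set0 -> A \subset I -> is_comp (I :\: A) F ->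
  comp_op I (A :: F) = conv_part A (I :\: A) I lin_id (comp_op (I :\: A) F).
Proof.
move=> A0 AI cF.
have c : is_comp I (A :: F) by rewrite is_comp_cons A0 AI.
have := is_comp_decomp c; rewrite decompE => /andP[_ /eqP eF].
rewrite -eF (comp_opE c).
(* A last block carries no unit factor in [mu_comp] and [Delta_comp], so the one-block case needs
   the unit law of convolution. *)
case: F c cF eF => [|B F] c cF eF.
  rewrite big_nil comp_op_nil /=.
  have e := is_comp_one c; subst I.
  rewrite conv_part_unitr; move: (is_comp_one c) => e.
  by rewrite (Prop_irrelevance e erefl); exact: linear_ext.
rewrite (comp_opE (is_comp_tail c)) (conv_partE (is_comp_decomp c)).
have -> (X : lmodType K) (m : {linear X -> h⟦\bigcup_(C <- B :: F) C⟧})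
    (D : {linear _ -> X}) :
    tens_map lin_id (m \lin_o D) =
    tens_map (@lin_id _ h⟦A⟧) m \lin_o tens_map lin_id D.
  by apply: linear_ext => y; rewrite lin_compE -tens_map_comp lin_comp1l.
exact: linear_ext.
Qed.

End CompOp.

(** * Evaluation of polynomials at the projection id - u *)

Section Evaluation.
Variables (K : fieldType) (h : bimonoid K).
Implicit Types p q : {poly K}.

Definition ev p : endo h := fun J I =>
  \sum_(F : composition I) p`_(size F) *: comp_op h I F.

Section Ambient.
Variable J : finType.
Implicit Types (A I S : {set J}) (F G : seq {set J}).

Lemma evP a p q I : ev (a *: p + q) I = a *: ev p I + ev q I.
Proof.
rewrite /ev scaler_sumr -big_split; apply: eq_bigr => F _ /=.
by rewrite coefD coefZ scalerDl scalerA.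
Qed.

Lemma ev_linear I : linear (fun p => ev p I).
Proof. by move=> a p q; exact: evP. Qed.

Lemma ev0 I : ev 0 I = 0.
Proof. exact: (linear0 (lin_of (ev_linear I))). Qed.

Lemma evZ a p I : ev (a *: p) I = a *: ev p I.
Proof. exact: (linearZ_LR (lin_of (ev_linear I))). Qed.

Lemma ev_sum (X : finType) (P : X -> {poly K}) I :
  ev (\sum_i P i) I = \sum_i ev (P i) I.
Proof. exact: (linear_sum (lin_of (ev_linear I))). Qed.

Lemma ev1 I : ev 1 I = conv_unit h I.
Proof.
rewrite /ev (sum_comp I (fun F => (1 : {poly K})`_(size F) *: comp_op h I F)).
rewrite [X in _ + X]big1 ?addr0 => [|A _]; last first.
  by rewrite big1 // => F _; rewrite coef1 scale0r.
have [->|I0] := eqVneq I set0; last by rewrite conv_unitN0.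
by rewrite coef1 scale1r comp_op_nil conv_unit0.
Qed.

(** Multiplying by ['X] shifts coefficients by one, which corresponds to adding a first block. *)
Lemma ev_Xmul p I : ev ('X * p) I =
  \sum_(A : {set J} | (A \subset I) && (A != set0))
    conv_part A (I :\: A) I lin_id (ev p (I :\: A)).
Proof.
rewrite /ev (sum_comp I (fun F => ('X * p)`_(size F) *: comp_op h I F)).
rewrite coefXM scale0r if_same add0r; apply: eq_bigr => A /andP[AI A0].
rewrite conv_part_sumr; apply: eq_bigr => F _.
by rewrite coefXM /= conv_partZr comp_op_cons ?blocksP.
Qed.

Lemma evX I : ev 'X I = if I == set0 then 0 else lin_id.
Proof.
rewrite -['X]mulr1 ev_Xmul.
have [->|I0] := eqVneq I set0.
  by rewrite big1 // => A /andP[]; rewrite subset0 => ->.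
(* Only [A = I] contributes, because the unit vanishes on the nonempty complement of a proper
   subset. *)
rewrite (bigD1 I) ?subxx //= big1 => [|A /andP[/andP[sAI A0] AI]]; rewrite ev1.
  by rewrite addr0 setDv conv_unit0 conv_part_unitr.
rewrite conv_unitN0 ?conv_part0r //.
by rewrite setD_eq0; apply: contra AI => IA; rewrite eqEsubset sAI.
Qed.

(** Induction on [p] in Horner form: multiplying by ['X] is convolving with [ev 'X], and
    associativity gives the inductive step. *)
Lemma ev_conv p q I : ev (p * q) I = conv (ev p) (ev q) I.
Proof.
have evXM r S : ev ('X * r) S = conv (ev 'X) (ev r) S.
  rewrite ev_Xmul convE [RHS](bigID (fun A => A == set0)) /= [X in X + _]big1 ?add0r.
    by apply: eq_bigr => A /andP[_ /negbTE A0]; rewrite evX A0.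
  by move=> A /andP[_ A0]; rewrite evX A0 conv_part0l.
elim/poly_ind: p I => [|p c IH] I.
  by rewrite mul0r convE ev0 big1 // => A _; rewrite ev0 conv_part0l.
have -> : (p * 'X + c%:P) * q = c *: q + 'X * (p * q).
  by rewrite mulrDl addrC mul_polyC mulrAC mulrC.
have -> : p * 'X + c%:P = c *: 1 + 'X * p by rewrite alg_polyC addrC mulrC.
rewrite evP evXM.
(* After reassociation, and with [ev q] written as its convolution with the unit, every term has the
   right factor [ev q]. *)
rewrite (eq_conv (f' := ev 'X) (g' := conv (ev p) (ev q))) // -convA.
rewrite -[X in _ *: X + _](conv_unitl (ev q)) !convE scaler_sumr -big_split.
by apply: eq_bigr => A _ /=; rewrite evP ev1 evXM conv_partPl.
Qed.

Lemma conv_pow_ev (f : endo h) p n I :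
  (forall S, f J S = ev p S) -> conv_pow f n I = ev (p ^+ n) I.
Proof.
move=> fE; elim: n I => [|n IH] I; first by rewrite ev1.
by rewrite exprS ev_conv; apply: eq_conv.
Qed.

End Ambient.

End Evaluation.

(** * The logarithm of the identity as a polynomial in the projection *)

Section Logarithm.
Variables (K : fieldType) (h : bimonoid K) (J : finType).
Implicit Types (A I S : {set J}) (F G : seq {set J}).

(** In dimension one the image of 1 under the unit, nonzero because the counit sends it to 1, spans
    the space and is fixed by the composite. *)
Lemma connected_iota_epsilon :
  connected h -> iota0 h J \lin_o epsilon h J = lin_id.
Proof.
case=> e he.
(* [connected] concerns [h void]; the bijections [s] and [t] transport its spanning vector to the
   empty subset of [J]. *)
pose t (x : void) : elts (set0 : {set J}) := of_void _ x.
have E0 (x : elts (set0 : {set J})) : False by case: x => x; rewrite inE.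
pose s (x : elts (set0 : {set J})) : void := False_rect _ (E0 x).
have bs : bijective s by exists t => [x|[]]; case: (E0 x).
have bt : bijective t by exists s => [[]|x]; case: (E0 x).
have span x : exists a, x = a *: sp_map h bt e.
  have [a [eq_a _]] := he (sp_map h bs x); exists a.
  have bts : bijective (t \o s) by exact: bij_comp.
  rewrite -linearZ -eq_a -(sp_map_comp _ _ bts).
  have ts_id : t \o s = id by apply: funext => y; case: (E0 y).
  by move: bts; rewrite ts_id => bid; rewrite sp_map_id.
apply: linear_ext => x; rewrite lin_compE lin_idE.
have [b eb] := span (iota0 h J 1).
have b0 : b != 0.
  apply/eqP => b0; have := epsilon_iota0 h J.
  by rewrite eb b0 scale0r linear0 => /eqP; rewrite eq_sym oner_eq0.
have [a ->] := span x.
have -> : a *: sp_map h bt e = (a / b) *: iota0 h J 1.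
  by rewrite eb scalerA divfK.
by rewrite !linearZ_LR epsilon_iota0.
Qed.

(* The coefficient (-1)^(n-1) / n of log(1 + X), and 0 at n = 0 since 0^-1 = 0. *)
Definition log_poly N : {poly K} :=
  \poly_(n < N) (- (n%:R^-1 * (-1) ^+ n)).

(** By connectedness u - id also vanishes on the empty set, hence equals [ev] of [- 'X], and its
    powers are [ev] of powers of [- 'X]. *)
Lemma log_id_ev I : connected h -> log_id h I = ev h (log_poly #|J|.+1) I.
Proof.
move=> ch.
have powE n :
    conv_pow (fun J' (I' : {set J'}) => conv_unit h I' - lin_id) n I =
    (-1) ^+ n *: ev h 'X^n I.
  rewrite (conv_pow_ev (p := -1 *: 'X)) => [|S]; first by rewrite exprZn evZ.
  rewrite evZ evX.
  have [->|S0] := eqVneq S set0; last by rewrite conv_unitN0 // sub0r scaleN1r.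
  by rewrite conv_unit0 connected_iota_epsilon // subrr scaler0.
(* Compositions of subsets of [J] have at most [#|J|] blocks, so [ev 'X^n] vanishes for larger
   [n]. *)
rewrite /log_id (fsbigE (iota 1 #|J|)) ?iota_uniq //=; first last.
- move=> n /= n0; rewrite mem_iota n0 /= add1n ltnS -ltnNge => Jn.
  rewrite powE /ev big1 ?scaler0 // => F _.
  rewrite coefXn ltn_eqF ?scale0r //; apply: leq_ltn_trans Jn.
  exact: size_is_comp (blocksP F).
- by move=> n /=; rewrite mem_iota => /andP[].
rewrite /log_poly poly_def ev_sum.
rewrite -(big_mkord xpredT (fun n => ev h (- (n%:R^-1 * (-1) ^+ n) *: 'X^n) I)).
rewrite big_ltn // invr0 mul0r oppr0 scale0r ev0 add0r -sumrN /index_iota subSS subn0.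
rewrite big_seq_cond [RHS]big_seq; apply: eq_big => [n|n _].
  rewrite mem_iota andb_idr // => /andP[n0 _].
  exact: (@mem_set nat [set n | (0 < n)%N]%classic).
by rewrite powE evZ scalerA scaleNr.
Qed.

End Logarithm.

(** * Coefficients of the Eulerian idempotents *)

Section Weights.
Variables (K : fieldType) (J : finType).
Implicit Types (A B I S : {set J}) (F G r : seq {set J}).

Lemma is_comp_mem I G B : is_comp I G -> B \in G -> B != set0 /\ B \subset I.
Proof.
case/and3P=> G0 _ /eqP <- BG; split; last by rewrite (big_rem B BG) subsetUl.
by apply: contraNneq G0 => <-.
Qed.

Lemma is_comp_catr I r G : is_comp I (r ++ G) ->
  is_comp (I :\: \bigcup_(B <- r) B) G.
Proof.
elim: r I => [|A r IH] I /=; first by rewrite big_nil setD0.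
by rewrite is_comp_cons => /and3P[_ _ /IH]; rewrite setDDl big_cons.
Qed.

Lemma is_comp_catl I r G : is_comp I (r ++ G) ->
  \bigcup_(B <- r) B \subset I.
Proof.
case/and3P=> _ _ /eqP <-; rewrite big_cat /=; exact: subsetUl.
Qed.

(** Blocks outside the run are nonempty and disjoint from its union, hence not contained in it. *)
Lemma count_run I r G : is_comp I (r ++ G) ->
  count (fun B => B \subset \bigcup_(C <- r) C) (r ++ G) = size r.
Proof.
move=> c; have: all (fun B => B \subset \bigcup_(C <- r) C) r.
  by apply/allP => B Br; rewrite (big_rem B Br) subsetUl.
rewrite count_cat all_count => /eqP ->.
rewrite -[RHS]addn0; congr (_ + _)%N; apply/eqP; rewrite -leqn0 leqNgt -has_count.
apply/hasPn => B /(is_comp_mem (is_comp_catr c))[B0].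
rewrite subsetD => /andP[_ dB]; apply: contra B0 => Br.
by rewrite -(setIidPl Br) setI_eq0.
Qed.

(** The coefficient of [HH G] in [QQ F], on bare lists to allow recursion on the first block. *)
Definition weight F G : K :=
  if comp_le F G then (-1) ^+ (size G - size F) * (rel_length F G)%:R^-1 else 0.

Lemma comp_leP F G : reflect
  (exists runs, flatten runs = G /\ [seq \bigcup_(B <- r) B | r <- runs] = F)
  (comp_le F G).
Proof. exact: asboolP. Qed.

(** Each run is nonempty because its union is a block. This controls the truncated subtraction in
    the sign exponent. *)
Lemma comp_le_size I F G : is_comp I F -> comp_le F G -> (size F <= size G)%N.
Proof.
case/and3P=> F0 _ _ /comp_leP[runs [<- eF]].
move: F0; rewrite -eF size_map => {eF}.
elim: runs => //= r runs IH; rewrite inE negb_or => /andP[r0 /IH le].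
rewrite size_cat -add1n leq_add //.
by case: r r0 => //; rewrite big_nil eqxx.
Qed.

(** At most one prefix of [G] has union [A]; sign and relative length are multiplicative when that
    run is cut off. *)
Lemma weight_cons I A F G : is_comp I (A :: F) -> is_comp I G ->
  weight (A :: F) G =
  \sum_(m < size G | A == \bigcup_(B <- take m.+1 G) B)
    (-1) ^+ m * m.+1%:R^-1 * weight F (drop m.+1 G).
Proof.
move=> cAF cG; rewrite {1}/weight; case: ifP => [/comp_leP[] | nle]; last first.
  rewrite big1 // => m /eqP eA; rewrite /weight ifF ?mulr0 //.
  apply: contraFF nle => /comp_leP[runs [eG eF]]; apply/comp_leP.
  by exists (take m.+1 G :: runs); rewrite /= eG cat_take_drop eF -eA.
case=> [|r runs] [eG] //= [eA eF].
move: (cAF); rewrite is_comp_cons => /and3P[A0 AI cF].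
have r0 : (0 < size r)%N by case: r eA {eG} A0 => // <-; rewrite big_nil eqxx.
have {}eG : r ++ flatten runs = G := eG.
set G' := flatten runs in eG.
have mG : ((size r).-1 < size G)%N by rewrite -eG size_cat prednK // leq_addr.
have takeE : take (size r).-1.+1 G = r by rewrite prednK // -eG take_size_cat.
have dropE : drop (size r).-1.+1 G = G' by rewrite prednK // -eG drop_size_cat.
rewrite (bigD1 (Ordinal mG)) /= ?takeE ?eA // dropE big1 ?addr0; last first.
  (* The prefix length is forced: both [m.+1] and [size r] count the blocks of [G] contained in
     [A]. *)
  move=> m /andP[/eqP eAm /eqP mr]; case: mr; apply: val_inj => /=.
  have := cG; rewrite -{1}(cat_take_drop m.+1 G) => /count_run.
  rewrite cat_take_drop -eAm size_takel // -eA => cm.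
  by have := cG; rewrite -{1}eG => /count_run; rewrite eG cm => <-.
have le' : comp_le F G' by apply/comp_leP; exists runs.
have sle := comp_le_size cF le'.
have cG' : is_comp (I :\: A) G' by move: cG; rewrite -eG => /is_comp_catr; rewrite eA.
rewrite /weight le' mulrACA -exprD -invfM -natrM; congr (_ ^+ _ * _%:R^-1).
  by rewrite -eG size_cat /= -{1}(prednK r0) addSn subSS addnBA.
rewrite /rel_length big_cons prednK //; congr (_ * _)%N.
  by rewrite -eA -eG; apply: count_run (I) _ _ _; rewrite eG.
rewrite !big_seq; apply: eq_bigr => B BF; rewrite -eG count_cat.
(* A block of the first run lying in a block of [F] would lie both in [A] and in a set disjoint from
   [A], hence be empty. *)
rewrite [count _ r](_ : _ = 0%N) //; apply/eqP; rewrite -leqn0 leqNgt -has_count.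
have [_] := is_comp_mem cF BF; rewrite subsetD => /andP[_ dB].
apply/hasPn => C Cr; apply/negP => CB.
have [] := is_comp_mem cG (_ : C \in G); first by rewrite -eG mem_cat Cr.
move=> C0 _; case/eqP: C0; apply/eqP; rewrite -subset0.
move: dB; rewrite -setI_eq0 => /eqP <-; rewrite subsetI CB -eA.
by rewrite (big_rem C Cr) subsetUl.
Qed.

(** Induction on [k]: choosing the first run of [G] is one step of the Cauchy product for powers of
    [log_poly]. *)
Lemma sum_weight N k I G : is_comp I G -> (size G < N)%N ->
  \sum_(F : composition I | size F == k) weight F G = (log_poly K N ^+ k)`_(size G).
Proof.
elim: k I G => [|k IH] I G cG GN; rewrite big_mkcond.
  rewrite (sum_comp I (fun F => if size F == 0%N then weight F G else 0)) /=.
  rewrite expr0 coef1 [X in _ + X]big1 ?addr0 => [|A _]; last by rewrite big1.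
  case: G cG GN => [|B G] cG GN.
    rewrite is_comp_nilE in cG; rewrite cG /weight ifT.
      by rewrite /rel_length big_nil invr1 mulr1.
    by apply/comp_leP; exists [::].
  rewrite is_comp_cons in cG; case/and3P: cG => B0 BI _.
  by rewrite ifF //; apply: contraNF B0 => /eqP I0; rewrite -subset0 -I0.
rewrite (sum_comp I (fun F => if size F == k.+1 then weight F G else 0)) /= if_same add0r.
transitivity (\sum_(A : {set J} | (A \subset I) && (A != set0))
    \sum_(m < size G | A == \bigcup_(B <- take m.+1 G) B)
    \sum_(F : composition (I :\: A) | size F == k)
    (-1) ^+ m * m.+1%:R^-1 * weight F (drop m.+1 G)).
  apply: eq_bigr => A /andP[AI A0]; rewrite exchange_big [RHS]big_mkcond /=.
  apply: eq_bigr => F _; rewrite eqSS; case: eqP => // _.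
  by apply: (weight_cons (I := I)) => //; rewrite is_comp_cons A0 AI blocksP.
(* Once the prefix length is fixed, [A] is determined. On the other side the index 0 drops out
   because [log_poly] has zero constant coefficient, leaving degrees [m.+1]. *)
rewrite (exchange_big_dep xpredT) //= exprS coefM big_ord_recl.
rewrite coef_poly invr0 mul0r oppr0 if_same mul0r add0r.
apply: eq_bigr => m _.
have cm : is_comp I (take m.+1 G ++ drop m.+1 G) by rewrite cat_take_drop.
rewrite (big_pred1 (\bigcup_(B <- take m.+1 G) B)) => [|A /=]; last first.
  rewrite andb_idl // => /eqP ->; rewrite (is_comp_catl cm) /=.
  case: G m cG cm {GN} => [|B G] m cG cm; first by case: m cm.
  apply/negP => /eqP; rewrite /= big_cons => /eqP; rewrite setU_eq0 => /andP[B0 _].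
  by rewrite is_comp_cons B0 in cG.
have mN : (m.+1 < N)%N by apply: leq_ltn_trans GN.
rewrite -mulr_sumr (IH _ _ (is_comp_catr cm)); last first.
  by rewrite size_drop; apply: leq_ltn_trans GN; exact: leq_subr.
rewrite coef_poly lift0 mN size_drop; congr (_ * _).
by rewrite exprS mulN1r mulrN opprK mulrC.
Qed.

End Weights.

(** * From the weights to the coefficients of E_k *)

Section EulerCoefficients.
Variables (K : fieldType) (J : finType) (I : {set J}).
Implicit Types F G : composition I.

Lemma supp_partition F : partition (supp F) I /\ #|supp F| = size F.
Proof.
have /and3P[F0 pF /eqP eF] := blocksP F.
have unF : uniq F.
  elim: {eF} (blocks F) F0 pF => //= A s IH.
  rewrite inE negb_or => /andP[A0 s0] /andP[dA ps].
  rewrite IH // andbT; apply: contra A0 => As.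
  by move/allP/(_ A As): dA; rewrite -setI_eq0 setIid eq_sym.
split; last by rewrite cardsE (card_uniqP unF).
apply/and3P; split; last by rewrite inE.
  apply/eqP; apply: etrans eF; rewrite /cover (big_uniq _ unF).
  by apply: eq_bigl => B; rewrite inE.
apply/trivIsetP => A B; rewrite !inE.
elim: {eF unF} (blocks F) pF {F0} => //= C s IH /andP[/allP dC ps].
rewrite !inE => /predU1P[->|As] /predU1P[->|Bs]; rewrite ?eqxx // => AB.
- exact: dC.
- by rewrite disjoint_sym; apply: dC.
- exact: IH.
Qed.

(** Grouping compositions by support works because the factorial depends only on the number of
    blocks. *)
Lemma sum_EE k :
  \sum_(X : {set {set J}} | partition X I && (#|X| == k)) EE K I X =
  (k`!)%:R^-1 *: \sum_(F : composition I | size F == k) QQ K F.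
Proof.
rewrite (partition_big (fun F => supp F) (fun X => partition X I && (#|X| == k))) /=.
  rewrite scaler_sumr; apply: eq_bigr => X /andP[_ /eqP Xk].
  rewrite /EE Xk; congr (_ *: _); apply: eq_bigl => F.
  rewrite andb_idl // => /eqP FX.
  by have [_ <-] := supp_partition F; rewrite FX Xk.
by move=> F /eqP <-; have [-> ->] := supp_partition F; rewrite eqxx.
Qed.

Lemma QQE F G : QQ K F G = weight K F G.
Proof.
rewrite /QQ sum_ffunE big_mkcond (bigD1 G) //= big1 ?addr0 => [|G' G'G].
  by rewrite /weight; case: ifP => // _; rewrite !ffunE eqxx [_ *: _]mulr1.
by case: ifP => // _; rewrite !ffunE eq_sym (negbTE G'G) scaler0.
Qed.

(** The separate values on the empty set match the polynomial side: the zeroth power is 1, and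
    higher powers have zero constant coefficient. *)
Lemma EulerE k G N : (size G < N)%N ->
  Euler K I k G = (k`!)%:R^-1 * (log_poly K N ^+ k)`_(size G).
Proof.
move=> GN; rewrite /Euler; case: k => [|k].
  rewrite fact0 invr1 mul1r expr0 coef1; case: {-}_ / idP => [I0|I0].
    by rewrite ffunE -val_eqE /= size_eq0.
  rewrite ffunE; case: eqP => // /size0nil G0; case: I0.
  by have := blocksP G; rewrite G0 is_comp_nilE.
case: {-}_ / idP => [I0|I0].
  rewrite ffunE; have -> : size G = 0%N.
    move: (blocks G) (blocksP G) => s; rewrite (eqP I0); case: s => //= A s.
    by rewrite is_comp_cons subset0 => /and3P[/negbTE ->].
  by rewrite exprS coef0M coef_poly invr0 mul0r oppr0 if_same mul0r mulr0.
rewrite sum_EE ffunE sum_ffunE; congr (_ * _).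
rewrite -(sum_weight K k.+1 (blocksP G) GN).
by apply: eq_bigr => F _; exact: QQE.
Qed.

End EulerCoefficients.

Theorem proposition103 (K : fieldType) (h : bimonoid K) (k : nat) :
  [pchar K] =i pred0 -> connected h ->
  forall (J : finType) (I : {set J}),
    Psi h (fun J I => Euler K I k) I =
    (k`!)%:R^-1 *: conv_pow (log_id h) k I.
Proof.
move=> _ ch J I.
(* One truncation serves all subsets of [J], hence all components entering the convolution power. *)
rewrite (conv_pow_ev (p := log_poly K #|J|.+1)) => [|S]; last exact: log_id_ev.
(* In [Psi] the scalars, hence the sum, live over K^o: its zmodType structure on
   linear maps is not convertible to the one over K. *)
transitivity (\sum_(F : composition I) (Euler K I k F : K) *:
    (mu_comp h (blocksP F) \lin_o Delta_comp h (blocksP F))).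
  by apply: linear_ext => x; rewrite !lin_sumE.
rewrite /ev scaler_sumr; apply: eq_bigr => F _.
rewrite scalerA (comp_opE h (blocksP F)) (@EulerE _ _ _ k F #|J|.+1) //.
by rewrite ltnS (size_is_comp (blocksP F)).
Qed.
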